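(* Let $m,n,m',n'\ge 3$ and $l,l'\ge -1$ be integers. If the dumbbell graphs $D(m,l,n)$ and $D(m',l',n')$ are non-isomorphic, then $X_{D(m,l,n)}\ne X_{D(m',l',n')}$.
   Context: All graphs are finite and simple; $C_n$ is the cycle and $P_l$ the path on the indicated number of vertices. For $m,n\ge 3$ and $l\ge 2$, the dumbbell graph $D(m,l,n)$ consists of disjoint $C_m$, $C_n$ and $P_l$, with one leaf of $P_l$ connected by an edge to one vertex of $C_m$ and the other leaf connected by an edge to one vertex of $C_n$. For $l=1$, the single vertex of $P_1$ is adjacent to one vertex of $C_m$ and to one vertex of $C_n$. For $l=0$, $D(m,0,n)$ is $C_m$ and $C_n$ (disjoint) connected by an edge. For $l=-1$, $D(m,-1,n)$ is $C_m$ and $C_n$ sharing exactly one vertex. In all cases $D(m,l,n)$ has $m+l+n$ vertices. The chromatic symmetric function of a graph $G$ with vertices $v_1,\ldots,v_d$ is $X_G=\sum_{\kappa} x_{\kappa(v_1)}\cdots x_{\kappa(v_d)}$, the sum over all proper colourings $\kappa:V(G)\to\mathbb{N}$, with $x_1,x_2,\ldots$ commuting variables. *)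

(* Defs.v *)
From mathcomp Require Import all_boot all_order all_algebra finmap monalg.
From mathcomp Require Import zify.
From mathcomp Require Import mathcomp_extra boolp classical_sets cardinality
  fsbigop.

Set Implicit Arguments.
Unset Strict Implicit.
Unset Printing Implicit Defensive.

Import Order.TTheory GRing.Theory Num.Theory.

Record sgraph : Type := SGraph {
  vertex :> finType;
  adj : rel vertex;
  adj_sym : symmetric adj;
  adj_irr : irreflexive adj }.

Definition graph_iso (G H : sgraph) : Prop :=
  exists2 f : G -> H, bijective f & forall u v, adj (f u) (f v) = adj u v.

Section ChromaticSymmetricFunction.

Variable G : sgraph.

Local Open Scope classical_set_scope.
Local Open Scope ring_scope.

(* The colours 1, 2, ... are shifted to 0, 1, ... *)
Definition proper_colouring : set {ffun G -> nat} :=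
  [set k | forall u v : G, adj u v -> k u != k v].

(* The monomial x_{k(v_1)} ... x_{k(v_d)}, in the free commutative monoid on
   the variables x_i, i : nat. *)
Definition colouring_monomial (k : {ffun G -> nat}) : {cmonom nat} :=
  \big[mmul/mone]_(v : G) ucm (k v).

(* A formal power series in x_0, x_1, ... is the function sending a monomial to
   its coefficient. The sum defining X_G is infinite, but coefficientwise it is
   finitely supported (see chromatic_sym_finite below), so that the
   finite-support sum over the set of all proper colourings is the actual sum. *)
Definition chromatic_sym : {cmonom nat} -> int := fun a =>
  \sum_(k \in proper_colouring) ((colouring_monomial k == a)%:R : int).

Lemma colouring_monomialE (k : {ffun G -> nat}) (i : nat) :
  colouring_monomial k i = #|[set v | k v == i]%SET|.
Proof.
rewrite /colouring_monomial -sum1dep_card [RHS]big_mkcond /=.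
elim/big_rec2: _ => [|v y m _ <-]; first exact: cm1.
by rewrite cmM cmU; case: (k v == i).
Qed.

Lemma chromatic_sym_finite (a : {cmonom nat}) :
  finite_set [set k : {ffun G -> nat} | colouring_monomial k = a].
Proof.
pose F (g : {ffun G -> finsupp a}) : {ffun G -> nat} := [ffun v => val (g v)].
apply: (@sub_finite_set _ _ (F @` setT)); last exact: finite_image.
move=> k /= ka.
have kin v : k v \in finsupp a.
  rewrite mem_finsupp -ka colouring_monomialE -lt0n.
  by apply/card_gt0P; exists v; rewrite inE.
exists [ffun v => [` kin v]%fset] => //.
by apply/ffunP => v; rewrite !ffunE.
Qed.

End ChromaticSymmetricFunction.

(* Adjacency, listed with i < j, of the path a, a + 1, ..., b, and of the
   cycle a, a + 1, ..., b, a. *)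
Definition path_edge (a b i j : nat) : bool := [&& a <= i, j == i.+1 & j <= b].
Definition cycle_edge (a b i j : nat) : bool :=
  path_edge a b i j || [&& i == a & j == b].

Section Dumbbell.

Variables (m : nat) (l : int) (n : nat).

Local Open Scope ring_scope.

Definition dumbbell_order : nat := absz (m%:Z + l + n%:Z).

(* The first vertex of the second cycle. *)
Definition dumbbell_snd : nat := absz (m%:Z + l).

(* The vertices are numbered consecutively: C_m is 0, ..., m - 1; for l >= 0,
   P_l is m, ..., m + l - 1; C_n is m + l, ..., m + l + n - 1. The path from
   m - 1 to m + l consists of P_l and its two connecting edges if l >= 1, and
   is the single connecting edge if l = 0. If l = -1, then the second cycle
   starts at m - 1, which is the shared vertex, and this path has no edge. *)
Definition dumbbell_edge (i j : nat) : bool :=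
  [|| cycle_edge 0 m.-1 i j, path_edge m.-1 dumbbell_snd i j
    | cycle_edge dumbbell_snd dumbbell_order.-1 i j].

(* The conjunct i != j only matters for m, n and l outside the intended range
   m, n >= 3 and l >= -1. *)
Definition dumbbell_adj : rel 'I_dumbbell_order := fun i j =>
  (i != j) && (dumbbell_edge i j || dumbbell_edge j i).

Lemma dumbbell_adj_sym : symmetric dumbbell_adj.
Proof. by move=> i j; rewrite /dumbbell_adj eq_sym orbC. Qed.

Lemma dumbbell_adj_irr : irreflexive dumbbell_adj.
Proof. by move=> i; rewrite /dumbbell_adj eqxx. Qed.

Definition dumbbell : sgraph := SGraph dumbbell_adj_sym dumbbell_adj_irr.

Lemma card_dumbbell : (3 <= m)%N -> (3 <= n)%N -> -1 <= l ->
  #|dumbbell|%:Z = m%:Z + l + n%:Z.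
Proof. by move=> hm hn hl; rewrite card_ord /dumbbell_order; lia. Qed.

Lemma dumbbell_edge_neq (i j : nat) : (3 <= m)%N -> (3 <= n)%N -> -1 <= l ->
  dumbbell_edge i j -> i != j.
Proof.
rewrite /dumbbell_edge /cycle_edge /path_edge /dumbbell_snd /dumbbell_order.
by lia.
Qed.

End Dumbbell.

(* Main.v *)
Require Import Defs.
From mathcomp Require Import all_boot all_order all_algebra.
From mathcomp Require Import finmap monalg zify ring.
From mathcomp Require Import classical_sets fsbigop.

(** Dumbbells are already separated by their chromatic polynomials, and the
    chromatic symmetric function determines the chromatic polynomial: the
    number of proper colourings with the k colours i < k is the sum of the
    coefficients of X_G over the monomials in x_0, ..., x_(k-1) only
    (chromatic_sym_kproper).

    The vertex numbering 0, ..., N - 1 of D(m,l,n) is a Hamiltonian path, and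
    the edges off this path are the two chords that close the cycles.  Hence a
    proper colouring with k = t + 1 colours is a walk with N vertices in the
    complete graph K_k that splits into a walk of m - 1 steps not returning to
    its start, an unrestricted walk of l + 1 steps, and a walk of n - 1 steps
    not returning to its start.  By the symmetry of K_k the number of
    continuations never depends on the vertex reached, so the three counts
    multiply; with P(k) the number of proper k-colourings this gives
    (card_kproper_dumbbell)
      k P(k) = t^(l+3) (t^(m-1) + (-1)^m) (t^(n-1) + (-1)^n).

    As an identity between polynomials in t, this determines l and {m, n}
    (dumbbell_product_inj): the order of vanishing at 0 is l + 3, the degree
    then gives m + n, and the second lowest exponent is l + 2 + min(m, n).
    Finally D(m,l,n) and D(n,l,m) are isomorphic, by reversing the numbering
    (dumbbell_rev). *)

Set Implicit Arguments.
Unset Strict Implicit.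
Unset Printing Implicit Defensive.

Import Order.TTheory GRing.Theory Num.Theory.
Local Open Scope ring_scope.

(** * Counting k-colourings from the chromatic symmetric function *)

Section KColourings.
Variables (G : sgraph) (k : nat).

Definition kproper (f : {ffun G -> 'I_k}) : bool :=
  [forall u, forall v, adj u v ==> (f u != f v)].

Definition nat_colouring (f : {ffun G -> 'I_k}) : {ffun G -> nat} :=
  [ffun v => val (f v)].

Lemma nat_colouring_inj : injective nat_colouring.
Proof.
move=> f g /ffunP fg; apply/ffunP => v; apply: val_inj.
by have := fg v; rewrite !ffunE.
Qed.

Lemma kproperP f : reflect (proper_colouring (nat_colouring f)) (kproper f).
Proof.
apply: (iffP forallP) => [h u v uv|h u].
  by rewrite !ffunE; move/forallP/(_ v)/implyP: (h u); apply.
by apply/forallP => v; apply/implyP => /h; rewrite !ffunE.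
Qed.

(** Any colouring contributing to the coefficient of a uses only colours in the
    support of a, so the sum over all colourings reduces to a finite type. *)
Lemma chromatic_sym_coef (a : {cmonom nat}) :
  (forall i, a i != 0%N -> (i < k)%N) ->
  chromatic_sym G a =
  \sum_(f | kproper f) (colouring_monomial (nat_colouring f) == a)%:R.
Proof.
move=> ak; rewrite /chromatic_sym.
pose r := [seq nat_colouring f | f <- enum kproper].
have rP c : c \in r -> proper_colouring c.
  by case/mapP => f; rewrite mem_enum => /kproperP ? ->.
rewrite (@fsbigE _ _ _ _ _ r) //=.
- rewrite big_map big_enum_cond /=; apply: eq_bigl => f.
  by rewrite andb_idr // => ?; rewrite inE; apply/kproperP.
- by rewrite map_inj_uniq ?enum_uniq //; exact: nat_colouring_inj.
- move=> c cP cr; case: eqP => // ca; case/negP: cr.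
  have ck v : (c v < k)%N.
    apply: ak; rewrite -ca colouring_monomialE -lt0n.
    by apply/card_gt0P; exists v; rewrite inE.
  have cE : c = nat_colouring [ffun v => Ordinal (ck v)].
    by apply/ffunP => v; rewrite !ffunE.
  by rewrite cE map_f // mem_enum; apply/kproperP; rewrite -cE.
Qed.

Lemma colouring_monomial_support f i :
  colouring_monomial (nat_colouring f) i != 0%N -> (i < k)%N.
Proof.
rewrite colouring_monomialE -lt0n => /card_gt0P[v]; rewrite inE ffunE => /eqP <-.
exact: ltn_ord.
Qed.

(** The set s is left free so that the same one can serve two graphs: it only
    has to contain the monomials of all k-colourings, and no variable beyond
    the first k. *)
Lemma card_kproper_sum (s : seq {cmonom nat}) :
  uniq s -> (forall a, a \in s -> forall i, a i != 0%N -> (i < k)%N) ->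
  (forall f, colouring_monomial (nat_colouring f) \in s) ->
  (#|kproper|%:R : int) = \sum_(a <- s) chromatic_sym G a.
Proof.
move=> s_uniq sk s_all.
rewrite -sum1_card natr_sum big_seq.
under [RHS]eq_bigr => a /sk ak do rewrite (chromatic_sym_coef ak).
rewrite -big_seq exchange_big /=; apply: eq_bigr => f _.
rewrite (bigD1_seq _ (s_all f) s_uniq) /= eqxx big1 ?addr0 // => a.
by rewrite eq_sym => /negbTE->.
Qed.

End KColourings.

(** Setting x_i = 1 for i < k and x_i = 0 otherwise turns X_G into the value at
    k of the chromatic polynomial. *)
Lemma chromatic_sym_kproper (G H : sgraph) (k : nat) :
  chromatic_sym G = chromatic_sym H -> #|@kproper G k| = #|@kproper H k|.
Proof.
move=> GH; pose mons K := codom (fun f => colouring_monomial (@nat_colouring K k f)).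
pose s := undup (mons G ++ mons H).
have sk a : a \in s -> forall i, a i != 0%N -> (i < k)%N.
  rewrite mem_undup mem_cat => /orP[] /codomP[f ->];
  exact: colouring_monomial_support.
apply/eqP; rewrite -(eqr_nat int) !(@card_kproper_sum _ k s) ?undup_uniq ?GH //.
all: by move=> f; rewrite mem_undup mem_cat codom_f ?orbT.
Qed.

(** * Colourings as words *)

Section Words.
Variable T : finType.

(** Lists, unlike tuples, can be concatenated without casts between equal
    lengths. *)
Fixpoint words (N : nat) : seq (seq T) :=
  if N is N'.+1 then [seq x :: s | x <- enum T, s <- words N'] else [:: [::]].

Lemma mem_words N s : (s \in words N) = (size s == N).
Proof.
elim: N s => [|N IH] [|x s] //=.
  by apply/allpairsP => -[[y w] []].
rewrite eqSS -IH; apply/allpairsP/idP => [[[y w] [_ wN [_ ->]]] //|sN].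
by exists (x, s); split; rewrite // mem_enum.
Qed.

Lemma words_uniq N : uniq (words N).
Proof.
elim: N => //= N IH; rewrite allpairs_uniq ?enum_uniq // => -[x s] [y w] _ _ /=.
by case=> -> ->.
Qed.

Lemma sum_words_cons N (F : seq T -> int) :
  \sum_(w <- words N.+1) F w = \sum_x \sum_(s <- words N) F (x :: s).
Proof. by rewrite big_allpairs_dep big_enum. Qed.

Lemma sum_words_cat i j (F : seq T -> int) :
  \sum_(w <- words (i + j)) F w =
  \sum_(s <- words i) \sum_(s' <- words j) F (s ++ s').
Proof.
elim: i F => [|i IH] F; first by rewrite big_seq1.
by rewrite addSn !sum_words_cons; apply: eq_bigr => x _; rewrite IH.
Qed.

Lemma sum_words_ffun N (F : seq T -> int) :
  \sum_(f : {ffun 'I_N -> T}) F (codom f) = \sum_(w <- words N) F w.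
Proof.
rewrite -big_enum -(big_map (fun f : {ffun 'I_N -> T} => codom f) xpredT) /=.
apply: perm_big; apply: uniq_perm; rewrite ?words_uniq //.
  rewrite map_inj_uniq ?enum_uniq // => f g fg.
  apply/ffunP => i; have /eq_in_map := fg; apply; exact: mem_enum.
move=> w; rewrite mem_words; apply/mapP/eqP => [[f _ ->]|wN].
  by rewrite size_codom card_ord.
case: w wN => [N0|x s wN].
  subst N; have e0 (i : 'I_0) : T by case: i.
  exists [ffun i => e0 i]; first by rewrite mem_enum.
  by apply/esym/size0nil; rewrite size_codom card_ord.
set w := x :: s.
exists [ffun i : 'I_N => nth x w i]; first by rewrite mem_enum.
apply: (@eq_from_nth _ x); rewrite ?size_codom ?card_ord // wN => i iN.
by rewrite (nth_map (Ordinal iN)) ?size_enum_ord // ffunE nth_enum_ord.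
Qed.

End Words.

(** * Walks in a complete graph *)

Section Walks.
Variable T : finType.
Implicit Types (x y : T) (s : seq T).

Local Notation neq := (fun x y : T => x != y).
Local Notation q := (#|T|%:R : int).

Lemma sum_neq x (F : T -> int) :
  \sum_z (x != z)%:R * F z = \sum_z F z - F x.
Proof.
rewrite [in RHS](bigD1 x) //= [F x + _]addrC addrK [RHS]big_mkcond /=.
by apply: eq_bigr => z _; rewrite eq_sym; case: eqP; rewrite ?mul1r ?mul0r.
Qed.

Lemma sum_walks_step j x (Q : T -> bool) :
  \sum_(s <- words T j.+1) (path neq x s && Q (last x s))%:R =
  \sum_z (x != z)%:R *
    (\sum_(s <- words T j) (path neq z s && Q (last z s))%:R) :> int.
Proof.
rewrite sum_words_cons; apply: eq_bigr => z _; rewrite mulr_sumr.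
by apply: eq_bigr => s _ /=; case: (x != z); rewrite ?mul1r ?mul0r.
Qed.

Lemma card_walks j x :
  \sum_(s <- words T j) (path neq x s)%:R = (q - 1) ^+ j :> int.
Proof.
transitivity (\sum_(s <- words T j) (path neq x s && true)%:R : int).
  by apply: eq_bigr => s _; rewrite andbT.
elim: j x => [|j IH] x; first by rewrite big_seq1.
rewrite (sum_walks_step j x xpredT) sum_neq IH (eq_bigr _ (fun z _ => IH z)).
by rewrite sumr_const -[X in X - _]mulr_natl exprS mulrBl mul1r.
Qed.

(** This is the closed form of the powers of the adjacency matrix J - I of the
    complete graph, whose eigenvalues are q - 1 and -1; it is multiplied by q
    in order to stay in the integers. *)
Lemma card_walks_to j x y :
  q * \sum_(s <- words T j) (path neq x s && (last x s == y))%:R =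
  (q - 1) ^+ j - (-1) ^+ j + (x == y)%:R * (q * (-1) ^+ j).
Proof.
elim: j x => [|j IH] x; first by rewrite big_seq1 /= !expr0; ring.
rewrite (sum_walks_step j x (pred1 y)) sum_neq mulrBr IH mulr_sumr.
rewrite (eq_bigr _ (fun z _ => IH z)) big_split /= sumr_const.
rewrite (bigD1 y) //= eqxx big1; last by move=> z /negbTE ->; rewrite mul0r.
rewrite -[_ *+ #|T|]mulr_natl !exprS (mulr1n 1); ring.
Qed.

Lemma card_walks_away j x :
  q * \sum_(s <- words T j) (path neq x s && (last x s != x))%:R =
  (q - 1) * ((q - 1) ^+ j - (-1) ^+ j).
Proof.
transitivity (q * (q - 1) ^+ j -
    q * \sum_(s <- words T j) (path neq x s && (last x s == x))%:R).
  rewrite -(card_walks j x) -mulrBr -sumrB; congr (_ * _).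
  by apply: eq_bigr => s _; case: (path neq x s) => //=; case: (last x s == x).
rewrite card_walks_to eqxx (mulr1n 1); ring.
Qed.

(** A proper colouring of the Hamiltonian path 0, 1, ..., a + c + b with the two
    chords {0, a} and {a + c, a + c + b}; this graph is D(a + 1, c - 1, b + 1). *)
Definition dumbbell_word a c b (w : seq T) : bool :=
  if w is x :: s then
    let y := nth x w in
    [&& path neq x s, y a != y 0 & y (a + c + b)%N != y (a + c)%N]
  else false.

(** The word is cut into its first letter and three walks of a, c and b steps.
    The number of walks not returning to their start is the same from every
    vertex, so each sum factors out. *)
Lemma card_dumbbell_words a c b :
  q * \sum_(w <- words T (a + (c + b)).+1) (dumbbell_word a c b w)%:R =
  (q - 1) ^+ c * ((q - 1) * ((q - 1) ^+ a - (-1) ^+ a))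
               * ((q - 1) * ((q - 1) ^+ b - (-1) ^+ b)).
Proof.
pose away j x := \sum_(s <- words T j) (path neq x s && (last x s != x))%:R : int.
have awayE j x : q * away j x = (q - 1) * ((q - 1) ^+ j - (-1) ^+ j).
  exact: card_walks_away.
rewrite sum_words_cons.
have -> : \sum_x \sum_(s <- words T (a + (c + b))) (dumbbell_word a c b (x :: s))%:R
  = \sum_x \sum_(s1 <- words T a) (path neq x s1 && (last x s1 != x))%:R *
      \sum_(s2 <- words T c) (path neq (last x s1) s2)%:R *
         away b (last (last x s1) s2).
  apply: eq_bigr => x _; rewrite sum_words_cat [LHS]big_seq [RHS]big_seq.
  apply: eq_bigr => s1; rewrite mem_words => /eqP s1a.
  rewrite sum_words_cat mulr_sumr [LHS]big_seq [RHS]big_seq.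
  apply: eq_bigr => s2; rewrite mem_words => /eqP s2c.
  rewrite mulrA mulr_sumr [LHS]big_seq [RHS]big_seq.
  apply: eq_bigr => s3; rewrite mem_words => /eqP s3b.
  rewrite /dumbbell_word /=.
  have -> : nth x (x :: s1 ++ s2 ++ s3) a = last x s1.
    by rewrite -s1a -cat_cons nth_cat /= ltnSn -last_nth.
  have -> : nth x (x :: s1 ++ s2 ++ s3) (a + c) = last (last x s1) s2.
    rewrite -s1a -s2c -size_cat catA -cat_cons nth_cat /= ltnSn -last_nth.
    by rewrite last_cat.
  have -> : nth x (x :: s1 ++ s2 ++ s3) (a + c + b) = last (last (last x s1) s2) s3.
    rewrite -s1a -s2c -s3b -!size_cat catA -last_nth !last_cat //.
  rewrite !cat_path -!natrM !mulnb.
  by congr ((nat_of_bool _)%:R); rewrite -!andbA; do !bool_congr.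
case: (posnP #|T|) => [T0|Tpos].
  rewrite T0; ring.
have qn0 : q != 0 by rewrite pnatr_eq0 -lt0n.
(* One factor q for each of the two counts of non-returning walks; the sum over
   the first letter gives one of them back. *)
apply: (mulfI qn0).
pose A := (q - 1) * ((q - 1) ^+ a - (-1) ^+ a).
pose B := (q - 1) * ((q - 1) ^+ b - (-1) ^+ b).
transitivity (\sum_(x : T) ((q - 1) ^+ c * A * B)).
  rewrite !mulr_sumr; apply: eq_bigr => x _; rewrite mulrA.
  transitivity (q * away a x * ((q - 1) ^+ c * B)); last by rewrite awayE /A; ring.
  rewrite /away -!mulrA; congr (_ * _); rewrite mulr_sumr mulr_suml.
  apply: eq_bigr => s1 _; rewrite mulrCA; congr (_ * _).
  rewrite -(card_walks c (last x s1)) mulr_sumr mulr_suml.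
  by apply: eq_bigr => s2 _; rewrite mulrCA awayE.
by rewrite sumr_const -[LHS]mulr_natl.
Qed.

End Walks.

(** * The dumbbell graph *)

Lemma card_sum (T : finType) (P : T -> bool) :
  (#|P|%:R : int) = \sum_x (P x)%:R.
Proof.
rewrite -sum1_card natr_sum big_mkcond; apply: eq_bigr => x _.
by rewrite mulrb.
Qed.

Section DumbbellGraph.
Variables (m n : nat) (l : int).
Hypotheses (hm : (3 <= m)%N) (hn : (3 <= n)%N) (hl : -1 <= l).

Local Notation a := m.-1.
Local Notation b := n.-1.
Local Notation c := (absz (l + 1)).

Lemma dumbbell_orderE : dumbbell_order m l n = (a + (c + b)).+1.
Proof. by rewrite /dumbbell_order; lia. Qed.

(** For l = -1 the connecting path has no edge, but the numbering is still a
    Hamiltonian path since the second cycle then starts at m - 1. *)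
Lemma dumbbell_edgeE i j : (j < dumbbell_order m l n)%N ->
  dumbbell_edge m l n i j =
  [|| j == i.+1, (i == 0%N) && (j == a)
    | (i == (a + c)%N) && (j == (a + c + b)%N)].
Proof.
rewrite /dumbbell_edge /cycle_edge /path_edge /dumbbell_snd /dumbbell_order.
by move=> ?; lia.
Qed.

Lemma dumbbell_wordP (T : finType) (d : T) (w : seq T) :
  size w = dumbbell_order m l n ->
  reflect [/\ forall i, (i.+1 < size w)%N -> nth d w i != nth d w i.+1,
              nth d w 0 != nth d w a
            & nth d w (a + c) != nth d w (a + c + b)]
          (dumbbell_word a c b w).
Proof.
rewrite dumbbell_orderE; case: w => // x s sN.
have nthE i : (i < size (x :: s))%N -> nth x (x :: s) i = nth d (x :: s) i.
  exact: set_nth_default.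
rewrite /dumbbell_word !nthE; try (rewrite sN; lia).
rewrite [_ a == _]eq_sym [_ == nth d _ (a + c)]eq_sym.
apply: (iffP and3P) => -[p ? ?]; split=> //.
  by move=> i; move/(pathP d): p; apply.
by apply/(pathP d) => i; exact: p.
Qed.

Lemma kproper_dumbbell k (f : {ffun dumbbell m l n -> 'I_k}) :
  kproper f = dumbbell_word a c b (codom f).
Proof.
have N0 : (0 < dumbbell_order m l n)%N by rewrite dumbbell_orderE.
pose d := f (Ordinal N0).
have fE (i : 'I_(dumbbell_order m l n)) : nth d (codom f) i = f i.
  by rewrite (nth_map i) ?size_enum_ord // nth_ord_enum.
have fN : size (codom f) = dumbbell_order m l n by rewrite size_codom card_ord.
apply/forallP/(dumbbell_wordP d fN).
  move=> h.
  have key i j : (i < j < dumbbell_order m l n)%N -> dumbbell_edge m l n i j ->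
      nth d (codom f) i != nth d (codom f) j.
    move=> /andP[ij jN] ijE; have iN := ltn_trans ij jN.
    rewrite (fE (Ordinal iN)) (fE (Ordinal jN)).
    move/forallP/(_ (Ordinal jN))/implyP: (h (Ordinal iN)); apply.
    by rewrite /= /dumbbell_adj /= ijE andbT neq_ltn /= ij.
  split=> [i||]; rewrite ?fN => *; apply: key; rewrite ?dumbbell_edgeE ?eqxx ?orbT //;
  by have := dumbbell_orderE; lia.
move=> [h1 h2 h3] u; apply/forallP => v; apply/implyP => /andP[uv].
wlog suff key : u v uv / dumbbell_edge m l n u v -> f u != f v.
  by case/orP => e; [|rewrite eq_sym]; apply: key => //; rewrite eq_sym.
rewrite -!fE dumbbell_edgeE ?ltn_ord //.
case/or3P => [/eqP vE|/andP[/eqP uE /eqP vE]|/andP[/eqP uE /eqP vE]].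
- by rewrite vE; apply: h1; rewrite -vE fN.
all: by rewrite uE vE.
Qed.

Lemma card_kproper_dumbbell t :
  t.+1%:R * #|@kproper (dumbbell m l n) t.+1|%:R =
  t%:R ^+ c * (t%:R * (t%:R ^+ a - (-1) ^+ a))
            * (t%:R * (t%:R ^+ b - (-1) ^+ b)) :> int.
Proof.
have := card_dumbbell_words 'I_t.+1 a c b.
rewrite card_ord -dumbbell_orderE -sum_words_ffun.
rewrite -[X in X - 1]natr1 addrK => <-; congr (_ * _).
rewrite card_sum; apply: eq_bigr => f _.
by rewrite -kproper_dumbbell.
Qed.

End DumbbellGraph.

Section Reversal.
Variables (m n : nat) (l : int).
Hypotheses (hm : (3 <= m)%N) (hn : (3 <= n)%N) (hl : -1 <= l).

Lemma dumbbell_order_rev : dumbbell_order m l n = dumbbell_order n l m.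
Proof. by rewrite /dumbbell_order; lia. Qed.

Lemma dumbbell_edge_rev i j :
  (i < dumbbell_order m l n)%N -> (j < dumbbell_order m l n)%N ->
  dumbbell_edge n l m (dumbbell_order n l m - i.+1) (dumbbell_order n l m - j.+1)
  = dumbbell_edge m l n j i.
Proof.
move=> iN jN; have [N1 N2] := (dumbbell_orderE hm hn hl, dumbbell_orderE hn hm hl).
rewrite !dumbbell_edgeE //; last by lia.
have := dumbbell_order_rev; move: iN jN N1 N2.
move: (dumbbell_order m l n) (dumbbell_order n l m) (absz _) => N N' c.
move=> iN jN N1 N2 _.
have [hm' hn'] : (1 < m.-1)%N /\ (1 < n.-1)%N by lia.
lia.
Qed.

Lemma dumbbell_rev : graph_iso (dumbbell m l n) (dumbbell n l m).
Proof.
exists (fun i => rev_ord (cast_ord dumbbell_order_rev i)).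
  exists (fun i => cast_ord (esym dumbbell_order_rev) (rev_ord i)) => i;
  by rewrite ?cast_ordKV rev_ordK ?cast_ordK.
move=> u v; rewrite /= /dumbbell_adj (inj_eq rev_ord_inj) (inj_eq (@cast_ord_inj _ _ _)).
by rewrite /= !dumbbell_edge_rev // orbC.
Qed.

End Reversal.

(** * Recovering the parameters *)

(** Evaluates the equality tests whose truth value follows from the linear
    hypotheses in the context. *)
Ltac decide_eqs := repeat match goal with
  | |- context [nat_of_bool (@eq_op _ ?x ?y)] =>
     (rewrite (_ : (x == y) = false); last lia) ||
     (rewrite (_ : (x == y) = true); last lia)
  end.

(** With a <= b, the expanded product has the terms of exponents c + 2,
    c + 2 + a, c + 2 + b and c + 2 + a + b, each with coefficient 1 or -1.
    The first and the last exponent are strictly extremal, which gives c and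
    then a + b.  If a < a', then a < b because the sums agree, so that the
    exponent c + 2 + a occurs once on the left and not on the right. *)
Lemma dumbbell_product_inj (a b c a' b' c' : nat) :
  (0 < a)%N -> (0 < b)%N -> (0 < a')%N -> (0 < b')%N ->
  (forall t : nat,
    t%:R ^+ c * (t%:R * (t%:R ^+ a - (-1) ^+ a))
              * (t%:R * (t%:R ^+ b - (-1) ^+ b)) =
    t%:R ^+ c' * (t%:R * (t%:R ^+ a' - (-1) ^+ a'))
              * (t%:R * (t%:R ^+ b' - (-1) ^+ b')) :> int) ->
  c = c' /\ (a = a' /\ b = b' \/ a = b' /\ b = a').
Proof.
wlog ab : a b / (a <= b)%N.
  move=> W a0 b0 a'0 b'0 h; case/orP: (leq_total a b) => ab; first exact: W.
  have [//|-> H] := W b a ab b0 a0 a'0 b'0.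
    by move=> t; rewrite -h mulrAC.
  by split=> //; case: H => -[-> ->]; [right|left].
wlog ab' : a' b' / (a' <= b')%N.
  move=> W a0 b0 a'0 b'0 h; case/orP: (leq_total a' b') => ab'; first exact: W.
  have [//|-> H] := W b' a' ab' a0 b0 b'0 a'0.
    by move=> t; rewrite h mulrAC.
  by split=> //; case: H => -[-> ->]; [right|left].
move=> a0 b0 a'0 b'0 h.
pose P a c b : {poly int} :=
  'X^(c + a + b) - ((-1) ^+ b) *: 'X^(c + a) - ((-1) ^+ a) *: 'X^(c + b)
  + ((-1) ^+ a * (-1) ^+ b) *: 'X^c.
have hornerP (x y z t : nat) : (P x z.+2 y).[t%:R] =
    t%:R ^+ z * (t%:R * (t%:R ^+ x - (-1) ^+ x))
              * (t%:R * (t%:R ^+ y - (-1) ^+ y)).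
  by rewrite /P !(hornerD, hornerN, hornerZ, hornerXn) !(exprD, exprS); ring.
have PE : P a c.+2 b = P a' c'.+2 b'.
  apply/eqP; rewrite -subr_eq0; apply/negP => /negP D0.
  set D := _ - _ in D0.
  (* All natural numbers are roots of the difference. *)
  have := max_poly_roots D0 (rs := [seq (i%:R : int) | i <- iota 0 (size D)]).
  rewrite size_map size_iota ltnn => notD.
  suff: false by []; apply: notD.
    apply/allP => _ /mapP[t _ ->]; apply/rootP.
    by rewrite /D hornerD hornerN !hornerP h subrr.
  by rewrite map_inj_uniq ?iota_uniq //; exact: mulrIn.
have coefP i :
  (i == c.+2 + a + b)%N%:R - (-1) ^+ b * (i == c.+2 + a)%N%:R
    - (-1) ^+ a * (i == c.+2 + b)%N%:R + (-1) ^+ a * (-1) ^+ b * (i == c.+2)%N%:R =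
  (i == c'.+2 + a' + b')%N%:R - (-1) ^+ b' * (i == c'.+2 + a')%N%:R
    - (-1) ^+ a' * (i == c'.+2 + b')%N%:R
    + (-1) ^+ a' * (-1) ^+ b' * (i == c'.+2)%N%:R :> int.
  by have := congr1 (fun p : {poly int} => p`_i) PE; rewrite /P /= !coefE.
have cc' : c = c'.
  case: (ltngtP c c') => // lt; [have := coefP c.+2|have := coefP c'.+2];
  by decide_eqs; rewrite /= !(mulr0, mulr1, subr0, add0r, addr0) => /eqP;
     rewrite ?[0 == _]eq_sym mulf_eq0 !signr_eq0.
subst c'.
have ss' : (a + b = a' + b')%N.
  case: (ltngtP (a + b) (a' + b')) => // lt;
  [have := coefP (c.+2 + a' + b')%N|have := coefP (c.+2 + a + b)%N];
  by decide_eqs; rewrite /= !(mulr0, mulr1, subr0, add0r, addr0).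
have aa' : a = a'.
  case: (ltngtP a a') => // lt;
  [have := coefP (c.+2 + a)%N|have := coefP (c.+2 + a')%N];
  by decide_eqs; rewrite /= !(mulr0, mulr1, subr0, sub0r, add0r, addr0) => /eqP;
     rewrite ?[0 == _]eq_sym oppr_eq0 signr_eq0.
by split=> //; left; lia.
Qed.

Theorem theorem4p1 (m n m' n' : nat) (l l' : int)
  (hm : (3 <= m)%N) (hn : (3 <= n)%N) (hm' : (3 <= m')%N) (hn' : (3 <= n')%N)
  (hl : (-1 <= l)%R) (hl' : (-1 <= l')%R) :
  ~ graph_iso (dumbbell m l n) (dumbbell m' l' n') ->
  chromatic_sym (dumbbell m l n) <> chromatic_sym (dumbbell m' l' n').
Proof.
move=> not_iso XE; apply: not_iso.
have [||||t|ll' mn] := @dumbbell_product_inj m.-1 n.-1 (absz (l + 1)) m'.-1 n'.-1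
  (absz (l' + 1)); try lia.
  by rewrite -!card_kproper_dumbbell // (chromatic_sym_kproper t.+1 XE).
have -> : l' = l by lia.
have [[-> ->]|[-> ->]] : m' = m /\ n' = n \/ m' = n /\ n' = m by lia.
  by exists id => //; exists id.
exact: dumbbell_rev.
Qed.
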